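(* For every integer $q\geq 3$ and every rational number $r$ with $r>\tfrac12$, there exists $v\in\mathbb{N}$ such that \[ \frac{s_q(v^2)}{s_q(v)}=r. \]
   Context: For an integer $q\geq 2$ and $n\in\mathbb{N}$, $s_q(n)$ denotes the sum of the digits of $n$ written in base $q$. *)

(* Defs.v *)
From mathcomp Require Import all_boot all_order all_algebra.
Set Implicit Arguments.
Unset Strict Implicit.
Unset Printing Implicit Defensive.

(* The digit of n at position i in base q is (n %/ q ^ i) %% q.  For q >= 2,
   n < q ^ n, so all digits at positions i >= n vanish. *)
Definition digit_sum (q n : nat) : nat := \sum_(i < n) ((n %/ q ^ i) %% q).

(* Main.v *)
(* Idea: let u = q^a - q^b - c with a/2 < b < a and c small.  Every run of
   borrows of length n contributes about (q-1)n to a digit sum.  Thus s(u) is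
   (q-1)a up to a constant, whereas in
     t u^2 = t q^(2a) - 2t q^(a+b) + t q^(2b) - 2tc q^a + 2tc q^b + t c^2
   the runs have lengths a-b and 2b-a, so s(t u^2) is (q-1)b up to a constant.
   A sum v of k copies of u shifted by rapidly growing powers of q has
     s(v) = k s(u),   s(v^2) = k s(u^2) + C(k,2) s(2u^2),
   and if c is chosen so that s(u^2) = s(2u^2) = (q-1)(b+be) and
   s(u) = (q-1)(a-al), then for k = 2m+1 the ratio is (m+1)(b+be)/(a-al).  These
   values exhaust the rationals strictly between (m+1)/2 and m+1, and taking
   m = floor r reaches every r > 1/2 except r = 1, for which v = 1 works. *)
Require Import Defs.
From mathcomp Require Import all_boot all_order all_algebra.
From mathcomp Require Import zify ring.
Import Order.TTheory GRing.Theory Num.Theory.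
Local Open Scope ring_scope.

(** The definition reads [n] positions; passing to any sufficient length permits recursion on digits
    and explicit evaluation. *)
Lemma digit_sum_widen (q n m : nat) : (1 < q)%N -> (n < q ^ m)%N ->
  digit_sum q n = (\sum_(i < m) ((n %/ q ^ i) %% q))%N.
Proof.
move=> q_gt1 lt_nm; pose F i := ((n %/ q ^ i) %% q)%N.
have widen k K : (k <= K)%N -> (n < q ^ k)%N ->
    (\sum_(i < k) F i = \sum_(i < K) F i)%N.
  move=> le_kK lt_nk; rewrite (big_ord_widen K F le_kK) big_mkcond.
  apply: eq_bigr => i _; case: ltnP => // le_ki.
  by rewrite /F divn_small ?mod0n // (leq_trans lt_nk) ?leq_pexp2l // ltnW.
have lt_nn : (n < q ^ n)%N by apply: ltn_expl.
by rewrite [RHS](widen m (maxn n m)) ?leq_maxr // -(widen n) ?leq_maxl.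
Qed.

Lemma digit_sum0 (q : nat) : digit_sum q 0 = 0%N.
Proof. exact: big_ord0. Qed.

Lemma digit_sum_divn (q n : nat) : (1 < q)%N ->
  digit_sum q n = (digit_sum q (n %/ q) + n %% q)%N.
Proof.
move=> q_gt1; have lt_n : (n < q ^ n.+1)%N.
  by rewrite (ltn_trans (ltn_expl n q_gt1)) ?ltn_exp2l.
rewrite (digit_sum_widen q n n.+1) // big_ord_recl expn0 divn1 addnC.
have lt_nq : (n %/ q < q ^ n)%N.
  exact: leq_ltn_trans (leq_div n q) (ltn_expl n q_gt1).
rewrite (digit_sum_widen q (n %/ q) n) //; congr addn.
by apply: eq_bigr => i _; rewrite /= /bump add1n expnS divnMA.
Qed.

Lemma digit_sumS (q x d : nat) : (1 < q)%N -> (d < q)%N ->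
  digit_sum q (x * q + d)%N = (digit_sum q x + d)%N.
Proof.
move=> q_gt1 lt_dq; rewrite digit_sum_divn // divnMDl ?(ltnW q_gt1) //.
by rewrite modnMDl divn_small // modn_small // addn0.
Qed.

Lemma digit_sum_digit (q d : nat) : (1 < q)%N -> (d < q)%N -> digit_sum q d = d.
Proof.
by move=> q_gt1 /(digit_sumS q 0 d q_gt1); rewrite mul0n digit_sum0 !add0n.
Qed.

Lemma digit_sum_cat (q n x y : nat) : (1 < q)%N -> (y < q ^ n)%N ->
  digit_sum q (x * q ^ n + y)%N = (digit_sum q x + digit_sum q y)%N.
Proof.
move=> q_gt1; elim: n y => [|n IHn] y.
  by rewrite expn0 ltnS leqn0 => /eqP ->; rewrite muln1 digit_sum0 !addn0.
have q_gt0 := ltnW q_gt1.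
rewrite expnSr -ltn_divLR // => /IHn {}IHn.
have -> : (x * (q ^ n * q) + y = (x * q ^ n + y %/ q) * q + y %% q)%N.
  by rewrite mulnDl -addnA -divn_eq mulnA.
by rewrite digit_sumS ?ltn_pmod // IHn (digit_sum_divn q y) // addnA.
Qed.

(** All [n] digits of [q ^ n - 1] are [q - 1], so subtracting [y] from it never borrows and turns
    each digit [d] into [q - 1 - d]. *)
Lemma digit_sum_compl (q n y : nat) : (1 < q)%N -> (y < q ^ n)%N ->
  (digit_sum q (q ^ n - y.+1) + digit_sum q y = (q - 1) * n)%N.
Proof.
move=> q_gt1; elim: n y => [|n IHn] y.
  by rewrite expn0 ltnS leqn0 => /eqP ->; rewrite digit_sum0 muln0.
have q_gt0 := ltnW q_gt1.
rewrite expnSr -ltn_divLR // => lt_y.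
have lt_mod : (y %% q < q)%N by rewrite ltn_pmod.
have -> : (q ^ n * q - y.+1 = (q ^ n - (y %/ q).+1) * q + (q - (y %% q).+1))%N.
  rewrite {1}(divn_eq y q) -addnS mulnBl mulSn.
  have : ((y %/ q).+1 * q <= q ^ n * q)%N by rewrite leq_mul2r lt_y orbT.
  by rewrite mulSn; lia.
have := IHn _ lt_y; rewrite digit_sumS ?(digit_sum_divn q y) //; last by lia.
by rewrite mulnS; lia.
Qed.

(** One unit is taken from [x]: the difference is [(x - 1) * q ^ n] plus the [n]-digit complement of
    [y - 1]. *)
Lemma digit_sum_borrow (q n x y : nat) : (1 < q)%N -> (0 < x)%N ->
    (0 < y <= q ^ n)%N ->
  (digit_sum q (x * q ^ n - y) + digit_sum q (y - 1) =
   digit_sum q (x - 1) + (q - 1) * n)%N.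
Proof.
case: x y => // x [//|y] q_gt1 _ /= lt_y; rewrite !subSS !subn0 mulSn.
have -> : (q ^ n + x * q ^ n - y.+1 = x * q ^ n + (q ^ n - y.+1))%N by lia.
rewrite digit_sum_cat //; first by rewrite -addnA digit_sum_compl.
by rewrite ltn_subrL (leq_ltn_trans _ lt_y).
Qed.

(** Induction puts a new copy of [u] far to the left. The middle conclusion is carried along because
    [2 * u * v] is the cross term of the new square. *)
Lemma sparse_copies (q u k : nat) : (1 < q)%N ->
  exists v : nat,
    [/\ digit_sum q v = (k * digit_sum q u)%N,
        digit_sum q (2 * u * v) = (k * digit_sum q (2 * u ^ 2))%N
      & digit_sum q (v ^ 2) =
          (k * digit_sum q (u ^ 2) + 'C(k, 2) * digit_sum q (2 * u ^ 2))%N].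
Proof.
move=> q_gt1; elim: k => [|k [v [sv suv svv]]].
  by exists 0%N; rewrite !muln0 !mul0n exp0n // digit_sum0.
pose M := (v + 2 * u * v + v ^ 2)%N.
have ltM : (M < q ^ M)%N by apply: ltn_expl.
have [ltv ltuv ltvv] : [/\ v < q ^ M, 2 * u * v < q ^ M & v ^ 2 < q ^ M]%N.
  by split; apply: leq_ltn_trans ltM; rewrite /M; lia.
exists (u * q ^ M + v)%N; split.
- by rewrite digit_sum_cat // sv mulSn.
- have -> : (2 * u * (u * q ^ M + v) = 2 * u ^ 2 * q ^ M + 2 * u * v)%N by ring.
  by rewrite digit_sum_cat // suv mulSn.
have -> : ((u * q ^ M + v) ^ 2 =
           (u ^ 2 * q ^ M + 2 * u * v) * q ^ M + v ^ 2)%N by ring.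
by rewrite !digit_sum_cat // suv svv binS bin1; ring.
Qed.

Lemma block_square (t A B c : nat) : (2 <= A)%N -> (2 * c <= B)%N ->
  (t * (A * A * B - A * B - c) ^ 2 =
   ((t * A - 2 * t) * (A * B) + (t * B - 2 * t * c)) * (A * A * B) +
     (2 * t * c * (A * B) + t * c ^ 2))%N.
Proof.
move=> /subnKC <- /subnKC <-; set x := (A - 2)%N; set y := (B - 2 * c)%N.
have -> : (t * (2 + x) - 2 * t = t * x)%N by rewrite mulnDr mulnC addKn.
have -> : (t * (2 * c + y) - 2 * t * c = t * y)%N.
  by rewrite mulnDr mulnCA mulnA addKn.
(* [w] is [A * A * B - A * B - c] expanded in [x] and [y], free of subtractions, so that [ring]
   applies. *)
pose w := ((x + 2) * (x + 1) * y + c * (2 * x ^ 2 + 6 * x + 3))%N.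
have -> : ((2 + x) * (2 + x) * (2 * c + y) = w + c + (2 + x) * (2 * c + y))%N.
  by rewrite /w; ring.
by rewrite !addnK /w; ring.
Qed.

(* With a = 2d+e and b = d+e, the two runs of borrows have lengths d and e. *)
Lemma digit_sum_block (q c d e : nat) : (2 < q)%N -> (0 < c)%N ->
    (8 * c ^ 2 < q ^ d)%N -> (8 * c ^ 2 < q ^ e)%N ->
  let u := (q ^ (2 * d + e) - q ^ (d + e) - c)%N in
  (digit_sum q u + 1 + digit_sum q (c - 1) = (q - 1) * (2 * d + e))%N /\
  forall t, (0 < t <= 2)%N ->
    (digit_sum q (t * u ^ 2) + digit_sum q (2 * t - 1) +
       digit_sum q (2 * t * c - 1) =
     2 * digit_sum q (t - 1) + (q - 1) * (d + e) +
       digit_sum q (2 * t * c) + digit_sum q (t * c ^ 2))%N.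
Proof.
move=> q_gt2 c_gt0; have q_gt1 : (1 < q)%N by apply: ltnW.
have cc : (c <= c ^ 2)%N by rewrite -mulnn leq_pmulr.
have -> : (q ^ (2 * d + e) = q ^ d * q ^ d * q ^ e)%N.
  by rewrite expnD mul2n -addnn expnD.
set A := (q ^ d)%N; set B := (q ^ e)%N => ltA ltB.
have EAB : (q ^ (d + e) = A * B)%N by rewrite expnD.
have EAAB : (q ^ (2 * d + e) = A * A * B)%N by rewrite expnD mul2n -addnn expnD.
rewrite EAB /=.
have leAB : (8 * c ^ 2 * B + B <= A * B)%N.
  by rewrite -mulSnr leq_mul2r ltA orbT.
have leAAB : (8 * c ^ 2 * (A * B) + A * B <= A * A * B)%N.
  by rewrite -mulSnr -mulnA leq_mul2r ltA orbT.
have ge2AB : (2 * (A * B) <= 8 * c ^ 2 * (A * B))%N by rewrite leq_mul2r; lia.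
split.
  (* Merging both subtractions leaves a single borrow run, of length [2 * d + e]. *)
  have -> : (A * A * B - A * B - c = 1 * q ^ (2 * d + e) - (A * B + c))%N.
    by rewrite EAAB mul1n subnDA.
  have := @digit_sum_borrow q (2 * d + e) 1 (A * B + c) q_gt1 isT.
  rewrite EAAB subnn digit_sum0 add0n => <-; last by apply/andP; split; lia.
  have -> : (A * B + c - 1 = 1 * q ^ (d + e) + (c - 1))%N by rewrite EAB; lia.
  rewrite digit_sum_cat ?EAB; [|exact: q_gt1|by lia].
  by rewrite (digit_sum_digit q 1) // addnA.
move=> t /andP[t_gt0 t_le2].
have tcB : (t * c ^ 2 < A * B)%N.
  by rewrite (@leq_ltn_trans (2 * c ^ 2)) ?leq_mul2r ?t_le2 ?orbT //; lia.
have tc : (2 * t * c <= 4 * c ^ 2)%N by rewrite -mulnA; nia.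
have low : (2 * t * c * (A * B) + t * c ^ 2 < A * A * B)%N.
  have : (2 * t * c * (A * B) <= 4 * c ^ 2 * (A * B))%N.
    by rewrite leq_mul2r tc orbT.
  have : (4 * c ^ 2 * (A * B) <= 8 * c ^ 2 * (A * B))%N.
    by rewrite leq_mul2r; lia.
  by lia.
have ltB' : (2 * t * c < B)%N by lia.
have ltA' : (2 * t < A)%N by lia.
have tc_gt0 : (0 < 2 * t * c)%N by rewrite muln_gt0 c_gt0 muln_gt0 t_gt0.
have mid : ((t * B - 2 * t * c) * (A * A * B) +
            (2 * t * c * (A * B) + t * c ^ 2) < A * B * (A * A * B))%N.
  have leT : ((t * B - 2 * t * c).+1 <= A * B)%N.
    have : (t * B <= 2 * B)%N by rewrite leq_mul2r t_le2 orbT.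
    by have : (2 * B <= A * B)%N; [rewrite leq_mul2r; lia|lia].
  apply: leq_trans (leq_mul leT (leqnn (A * A * B)%N)).
  by rewrite [leqRHS]mulSnr ltn_add2l.
have EX : (q ^ (d + e + (2 * d + e)) = A * B * (A * A * B))%N.
  by rewrite expnD EAB EAAB.
(* The four blocks do not overlap; the upper two are differences, with borrow runs of lengths [d]
   and [e]. *)
have -> : (t * (A * A * B - A * B - c) ^ 2 =
  (t * A - 2 * t) * q ^ (d + e + (2 * d + e)) +
    ((t * B - 2 * t * c) * q ^ (2 * d + e) +
       (2 * t * c * q ^ (d + e) + t * c ^ 2)))%N.
  rewrite EX EAB EAAB block_square //; first by ring.
  - by lia.
  by lia.
do 3![rewrite digit_sum_cat; [|exact: q_gt1|by rewrite ?EX ?EAAB ?EAB]].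
have rangeA : (0 < 2 * t <= A)%N by rewrite muln_gt0 t_gt0 (ltnW ltA').
have rangeB : (0 < 2 * t * c <= B)%N by rewrite tc_gt0 (ltnW ltB').
have := @digit_sum_borrow q d t (2 * t) q_gt1 t_gt0 rangeA.
have := @digit_sum_borrow q e t (2 * t * c) q_gt1 t_gt0 rangeB.
rewrite -/A -/B.
by rewrite mulnDr; lia.
Qed.

(* The equations say that the constants in s(u) = (q-1)(a-al) and in
   s(u^2) = s(2u^2) = (q-1)(b+be) given by digit_sum_block are right for c. *)
Lemma block_constants (q : nat) : (2 < q)%N -> exists c al be : nat,
  [/\ (0 < c)%N,
      (1 + digit_sum q (c - 1) = (q - 1) * al)%N,
      (digit_sum q (2 * c) + digit_sum q (c ^ 2) =
         1 + digit_sum q (2 * c - 1) + (q - 1) * be)%N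
    & (2 + digit_sum q (4 * c) + digit_sum q (2 * c ^ 2) =
         digit_sum q 3 + digit_sum q (4 * c - 1) + (q - 1) * be)%N].
Proof.
move=> q_gt2; have q_gt1 := ltnW q_gt2; case: (ltnP 4 q) => [q_gt4|q_le4].
  have S x d : (d < q)%N -> digit_sum q (x * q + d)%N = (digit_sum q x + d)%N.
    exact: digit_sumS.
  have D d : (d < q)%N -> digit_sum q d = d by apply: digit_sum_digit.
  (* The expansions below are genuine base-[q] expansions because [q >= 5]; the tightest digit is
     [q - 5]. *)
  exists (q - 1)%N, 1%N, 1%N.
  have -> : (2 * (q - 1) - 1 = 1 * q + (q - 3))%N by lia.
  have -> : (2 * (q - 1) = 1 * q + (q - 2))%N by lia.
  have -> : (4 * (q - 1) - 1 = 3 * q + (q - 5))%N by lia.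
  have -> : (4 * (q - 1) = 3 * q + (q - 4))%N by lia.
  have -> : (2 * (q - 1) ^ 2 = (1 * q + (q - 4)) * q + 2)%N by nia.
  have -> : ((q - 1) ^ 2 = (q - 2) * q + 1)%N by nia.
  by rewrite !S ?D; try split; lia.
have /orP[/eqP ->|/eqP ->] : (q == 3) || (q == 4) by lia.
  (* 64 is the least c that works for q = 3 (found by computer search). *)
  exists 64%N, 2%N, 5%N.
  by rewrite !(@digit_sum_widen 3 _ 9) // !big_ord_recr !big_ord0.
exists 9%N, 1%N, 1%N.
by rewrite !(@digit_sum_widen 4 _ 5) // !big_ord_recr !big_ord0.
Qed.

(** [K] makes both [a - b] and [2 * b - a] long enough for the block computation. An odd number of
    copies gives ['C(2 * m + 1, 2) = (2 * m + 1) * m], so [2 * m + 1] cancels in the ratio. *)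
Lemma ratio_of_exponents (q m : nat) : (2 < q)%N -> exists al be K : nat,
  forall a b : nat, (b + K <= a)%N -> (a + K <= 2 * b)%N ->
  exists v : nat,
    (digit_sum q v = (2 * m + 1) * (q - 1) * (a - al))%N /\
    (digit_sum q (v ^ 2) = (2 * m + 1) * (q - 1) * ((m + 1) * (b + be)))%N.
Proof.
move=> q_gt2; have q_gt1 := ltnW q_gt2.
have [c [al [be [c_gt0 Ec1 Ec2 Ec3]]]] := @block_constants q q_gt2.
pose K := (8 * c ^ 2)%N; exists al, be, K => a b le_ba le_ab.
have ltK i : (K <= i)%N -> (8 * c ^ 2 < q ^ i)%N.
  by move=> le_Ki; exact: leq_ltn_trans le_Ki (ltn_expl i q_gt1).
pose d := (a - b)%N; pose e := (2 * b - a)%N.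
have [Ea Eb] : (2 * d + e = a /\ d + e = b)%N by rewrite /d /e; lia.
have ltd : (8 * c ^ 2 < q ^ d)%N by apply: ltK; rewrite /d; lia.
have lte : (8 * c ^ 2 < q ^ e)%N by apply: ltK; rewrite /e; lia.
have [] := @digit_sum_block q c d e q_gt2 c_gt0 ltd lte.
rewrite Ea Eb; set u := (_ - _ - _)%N => su suu.
have := suu 1%N isT; have := suu 2%N isT.
rewrite !muln1 !mul1n subnn digit_sum0 !(digit_sum_digit q 1) // => su2 su1.
have {}su1 : digit_sum q (u ^ 2) = ((q - 1) * (b + be))%N.
  by rewrite mulnDr; lia.
have {}su2 : digit_sum q (2 * u ^ 2) = ((q - 1) * (b + be))%N.
  by move: su2; rewrite -[(2 * 2)%N]/4%N -[(4 - 1)%N]/3%N mulnDr; lia.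
have {}su : digit_sum q u = ((q - 1) * (a - al))%N by rewrite mulnBr; lia.
have [v [sv _ svv]] := @sparse_copies q u (2 * m + 1) q_gt1; exists v.
have binE : 'C(2 * m + 1, 2) = ((2 * m + 1) * m)%N.
  by rewrite bin2 addn1 /= mulnCA mul2n doubleK.
by rewrite sv svv su su1 su2 binE; split; ring.
Qed.

Theorem theorem3p16 (q : nat) (r : rat) (hq : (3 <= q)%N) (hr : 1 / 2 < r) :
  exists v : nat,
    (0 < v)%N /\ (digit_sum q (v ^ 2)%N)%:R / (digit_sum q v)%:R = r.
Proof.
have q_gt1 : (1 < q)%N by apply: ltnW.
have [->|r_neq1] := eqVneq r 1.
  by exists 1%N; rewrite exp1n digit_sum_digit // divr1.
have r_gt0 : 0 < r by apply: lt_trans hr.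
pose D := `|denq r|%N; pose N := `|numq r|%N.
have D_gt0 : (0 < D)%N by rewrite absz_gt0 denq_neq0.
have Er : r = N%:R / D%:R.
  rewrite -[LHS]divq_num_den -[numq r]gez0_abs ?numq_ge0 ?ltW //.
  by rewrite -[denq r]gez0_abs // ltW.
have DK0 : (0 : rat) < D%:R by rewrite ltr0n.
have lt_D2N : (D < 2 * N)%N.
  move: hr; rewrite Er ltr_pdivlMr // mulrAC mul1r ltr_pdivrMr ?ltr0n //.
  by rewrite -natrM ltr_nat mulnC.
have neq_ND : N != D.
  by apply: contra_neq r_neq1 => eq_ND; rewrite Er eq_ND divff // lt0r_neq0.
pose m := (N %/ D)%N.
have lt_N : (N < (m + 1) * D)%N by rewrite addn1 ltn_ceil.
have le_N : (m * D <= N)%N by apply: leq_trunc_div.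
(* This says [(m + 1) / 2 < r]: for [m = 0] it is the hypothesis on [r], for [m = 1] it needs
   [r != 1], and for larger [m] it follows from [m <= r]. *)
have lt_mN : ((m + 1) * D < 2 * N)%N.
  have [m0|[m1|m2]] : (m = 0 \/ m = 1 \/ 2 <= m)%N by lia.
  - by rewrite m0 add0n mul1n.
  - by move: le_N; rewrite m1 mul1n; lia.
  by nia.
have [al [be [K vP]]] := @ratio_of_exponents q m hq.
(* Taking [a - al = (m + 1) * D * x] and [b + be = N * x] gives ratio [N / D]. The strict bounds on
   [N] make both gaps grow with [x], which is chosen to absorb [K], [al] and [be]. *)
pose x := (K + al + 2 * be + 1)%N.
have le1 : ((N + 1) * x <= (m + 1) * D * x)%N.
  by rewrite leq_mul2r addn1 lt_N orbT.
have le2 : (((m + 1) * D + 1) * x <= 2 * N * x)%N.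
  by rewrite leq_mul2r addn1 lt_mN orbT.
have le3 : (x <= N * x)%N by rewrite leq_pmull //; lia.
have [||v [sv svv]] := vP ((m + 1) * D * x + al)%N (N * x - be)%N.
- by rewrite /x in le1 le3 *; lia.
- by rewrite /x in le2 le3 *; lia.
move: sv svv; rewrite addnK subnK; last by rewrite /x in le3 *; lia.
move=> sv svv.
have sv_gt0 : (0 < digit_sum q v)%N.
  by rewrite sv !muln_gt0 D_gt0 /x; lia.
exists v; split; first by case: v sv_gt0 {sv svv} => //; rewrite digit_sum0.
apply/(canLR (mulfK _)); first by rewrite pnatr_eq0 -lt0n.
rewrite Er mulrAC; apply/(canRL (mulfK _)); first exact: lt0r_neq0.
by rewrite -!natrM sv svv; congr (_%:R); ring.
Qed.
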